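(* Suppose the plant graph $G_{\mathcal P}$ contains no isolated node, the design graph $G_{\mathcal C}$ is the totally disconnected graph with self-loops (i.e. $S_{\mathcal C}=I_q$), and $G_{\mathcal K}\supseteq G_{\mathcal P}$. Then the deadbeat control design method $\Gamma^{\Delta}(A,B)=-B^{-1}A$ is undominated in $\mathcal C$ for plants in $\mathcal P$ if and only if $G_{\mathcal P}$ has no sink.
   Context: Fix integers $q\ge 1$ and $n_1,\dots,n_q\ge 1$, put $n=\sum_{i=1}^q n_i$, and fix a real $\epsilon>0$. Matrices $M\in\mathbb R^{n\times n}$ are partitioned into blocks $M_{ij}\in\mathbb R^{n_i\times n_j}$, $1\le i,j\le q$. Graphs are directed with vertex set $\{1,\dots,q\}$, possibly with self-loops. The adjacency matrix $S=(s_{ij})$ of $G=(\{1,\dots,q\},E)$ is $s_{ij}=1$ if $(j,i)\in E$ and $s_{ij}=0$ otherwise. $G'\supseteq G$ means the edge set of $G'$ contains that of $G$. A vertex $i$ is a sink if there is no $j\ne i$ with $(i,j)\in E$; it is isolated if there is no $j\ne i$ with $(i,j)\in E$ or $(j,i)\in E$. Plants: given the plant graph $G_{\mathcal P}$ with adjacency matrix $S_{\mathcal P}$, let $\mathcal A(S_{\mathcal P})=\{A\in\mathbb R^{n\times n}: A_{ij}=0 \text{ whenever } (s_{\mathcal P})_{ij}=0\}$, and let $\mathcal B(\epsilon)$ be the set of diagonal $n\times n$ matrices with all diagonal entries $\ge\epsilon$. The set of plants is $\mathcal P=\mathcal A(S_{\mathcal P})\times\mathcal B(\epsilon)\times\mathbb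 R^n$; $P=(A,B,x_0)$ stands for the system $x(k+1)=Ax(k)+Bu(k)$, $x(0)=x_0$. Controllers: given the control graph $G_{\mathcal K}$ with adjacency matrix $S_{\mathcal K}$, let $\mathcal K=\{K\in\mathbb R^{n\times n}: K_{ij}=0 \text{ whenever } (s_{\mathcal K})_{ij}=0\}$; $K$ acts by $u(k)=Kx(k)$. Cost: $J_P(K)=\sum_{k=1}^\infty x(k)^Tx(k)+\sum_{k=0}^\infty u(k)^Tu(k)\in[0,\infty]$, evaluated along the closed loop of $P$ with $u=Kx$. Design methods: a control design method is a map $\Gamma:\mathcal A(S_{\mathcal P})\times\mathcal B(\epsilon)\to\mathcal K$. Given a design graph $G_{\mathcal C}$ with adjacency matrix $S_{\mathcal C}$, $\mathcal C$ is the set of control design methods $\Gamma$ with structure $G_{\mathcal C}$, meaning that for each $i$ the block row $[\Gamma_{i1}\ \cdots\ \Gamma_{iq}]$ is a function only of $\{[A_{j1}\ \cdots\ A_{jq}],\,B_{jj}: (s_{\mathcal C})_{ij}\ne 0\}$. Domination: $\Gamma$ dominates $\Gamma'$ if $J_P(\Gamma(A,B))\le J_P(\Gamma'(A,B))$ for all $P=(A,B,x_0)\in\mathcal P$, with strict inequality for at least one plant in $\mathcal P$. A method $\Gamma'\in\mathcal C$ is undominated in $\mathcal C$ for plants in $\mathcal P$ if no $\Gamma\in\mathcal C$ dominates $\Gamma'$. *)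

(* Defs.v *)
From HB Require Import structures.
From mathcomp Require Import all_boot all_order all_algebra.
From mathcomp Require Import all_classical all_reals all_analysis.

Set Implicit Arguments.
Unset Strict Implicit.
Unset Printing Implicit Defensive.

Import Order.TTheory GRing.Theory Num.Theory.
Local Open Scope classical_set_scope.
Local Open Scope ring_scope.

(* A directed graph on q vertices is its edge relation: [G i j] means that
   (i, j) is an edge.  Self-loops are allowed. *)
Definition digraph (q : nat) := rel 'I_q.

(* Note the transposition: entry (i, j) records the edge from j to i. *)
Definition adjmx (q : nat) (G : digraph q) : 'M[int]_q :=
  \matrix_(i, j) (G j i)%:R.

Definition graph_sub (q : nat) (G G' : digraph q) : Prop := subrel G G'.

Definition sink_node (q : nat) (G : digraph q) (i : 'I_q) : Prop :=
  ~ exists j : 'I_q, j != i /\ G i j.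

Definition isolated_node (q : nat) (G : digraph q) (i : 'I_q) : Prop :=
  ~ exists j : 'I_q, j != i /\ (G i j \/ G j i).

Definition total_dim (q : nat) (n_ : 'I_q -> nat) : nat := (\sum_(i < q) n_ i)%N.

Notation sqmx R n_ := 'M[R]_(total_dim n_) (only parsing).
Notation state R n_ := 'cV[R]_(total_dim n_) (only parsing).

(* A(S_P) when G is the plant graph, K when G is the control graph. *)
Definition structured (R : realType) (q : nat) (n_ : 'I_q -> nat)
    (G : digraph q) : set (sqmx R n_) :=
  [set M | forall i j : 'I_q, adjmx G i j = 0 -> submxblock M i j = 0].

Definition input_matrices (R : realType) (q : nat) (n_ : 'I_q -> nat)
    (eps : R) : set (sqmx R n_) :=
  [set B | is_diag_mx B /\ forall l : 'I_(total_dim n_), eps <= B l l].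

Definition plant (R : realType) (q : nat) (n_ : 'I_q -> nat) : Type :=
  (sqmx R n_ * sqmx R n_ * state R n_)%type.

Definition plants (R : realType) (q : nat) (n_ : 'I_q -> nat)
    (GP : digraph q) (eps : R) : set (plant R n_) :=
  structured GP `*` input_matrices eps `*` [set: state R n_].

Fixpoint closed_loop (R : realType) (n : nat) (A B K : 'M[R]_n)
    (x0 : 'cV[R]_n) (k : nat) : 'cV[R]_n :=
  if k is k'.+1 then
    let x := closed_loop A B K x0 k' in
    let u := K *m x in
    A *m x + B *m u
  else x0.

Definition sqnorm (R : realType) (n : nat) (x : 'cV[R]_n) : R :=
  (x^T *m x) 0 0.

Definition cost (R : realType) (q : nat) (n_ : 'I_q -> nat)
    (P : plant R n_) (K : sqmx R n_) : \bar R :=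
  let: (A, B, x0) := P in
  let x := closed_loop A B K x0 in
  let u := fun k : nat => K *m x k in
  ((\sum_(1 <= k <oo) (sqnorm (x k))%:E)
   + (\sum_(0 <= k <oo) (sqnorm (u k))%:E))%E.

(* Design methods are represented by total functions; every predicate below
   looks only at their values on A(S_P) x B(eps). *)
Definition design_method (R : realType) (q : nat) (n_ : 'I_q -> nat) : Type :=
  sqmx R n_ -> sqmx R n_ -> sqmx R n_.

(* The block row [M_i1 ... M_iq] is [submxcol M i]: [submxcol] extracts the
   i-th member of a column of blocks. *)
Definition block_row (R : realType) (q : nat) (n_ : 'I_q -> nat)
    (M : sqmx R n_) (i : 'I_q) : 'M[R]_(n_ i, total_dim n_) := submxcol M i.

Definition has_design_structure (R : realType) (q : nat) (n_ : 'I_q -> nat)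
    (GP GC : digraph q) (eps : R) (Gam : design_method R n_) : Prop :=
  forall (i : 'I_q) (A B A' B' : sqmx R n_),
    structured GP A -> input_matrices eps B ->
    structured GP A' -> input_matrices eps B' ->
    (forall j : 'I_q, adjmx GC i j != 0 ->
       block_row A j = block_row A' j /\
       submxblock B j j = submxblock B' j j) ->
    block_row (Gam A B) i = block_row (Gam A' B') i.

Definition design_methods (R : realType) (q : nat) (n_ : 'I_q -> nat)
    (GP GK GC : digraph q) (eps : R) : set (design_method R n_) :=
  [set Gam |
     (forall A B : sqmx R n_,
        structured GP A -> input_matrices eps B ->
        structured GK (Gam A B))
     /\ has_design_structure GP GC eps Gam].

Definition method_cost (R : realType) (q : nat) (n_ : 'I_q -> nat)
    (Gam : design_method R n_) (P : plant R n_) : \bar R :=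
  cost P (Gam P.1.1 P.1.2).

Definition dominates (R : realType) (q : nat) (n_ : 'I_q -> nat)
    (Pl : set (plant R n_)) (Gam Gam' : design_method R n_) : Prop :=
  (forall P, Pl P -> (method_cost Gam P <= method_cost Gam' P)%E) /\
  (exists P, Pl P /\ (method_cost Gam P < method_cost Gam' P)%E).

Definition undominated (R : realType) (q : nat) (n_ : 'I_q -> nat)
    (C : set (design_method R n_)) (Pl : set (plant R n_))
    (Gam' : design_method R n_) : Prop :=
  C Gam' /\ ~ exists Gam, C Gam /\ dominates Pl Gam Gam'.

Definition deadbeat (R : realType) (q : nat) (n_ : 'I_q -> nat) :
    design_method R n_ :=
  fun A B => - (invmx B *m A).

(* Main.v *)
(* If no vertex is a sink, a method that never does worse than deadbeat must
   itself be deadbeat: a state left nonzero after one step is carried along an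
   edge to another vertex, whose dynamics the local controller does not know and
   which can be chosen to make that state arbitrarily expensive.  Conversely,
   with deadbeat elsewhere, a state left at a sink [i] with [A_ii = 0] dies at no
   cost at the next step, so there one can minimise [|x(1)|^2 + |u(0)|^2]
   instead: the gain [b / (1 + b^2)] costs [1 / (1 + b^2)] where [1 / b] costs
   [1 / b^2]. *)

Require Import Defs.
From HB Require Import structures.
From mathcomp Require Import all_boot all_order all_algebra.
From mathcomp Require Import all_classical all_reals all_analysis.
From mathcomp Require Import ring lra.

Set Implicit Arguments.
Unset Strict Implicit.
Unset Printing Implicit Defensive.

Import Order.TTheory GRing.Theory Num.Theory.
Local Open Scope classical_set_scope.
Local Open Scope ring_scope.

(** * Squared norms and nonnegative series *)

Lemma sqnormE (R : realType) (n : nat) (x : 'cV[R]_n) :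
  sqnorm x = \sum_l x l 0 ^+ 2.
Proof. by rewrite /sqnorm mxE; apply: eq_bigr => l _; rewrite mxE expr2. Qed.

Lemma sqnorm_ge0 (R : realType) (n : nat) (x : 'cV[R]_n) : 0 <= sqnorm x.
Proof. by rewrite sqnormE sumr_ge0 // => l _; rewrite sqr_ge0. Qed.

Lemma sqnorm0 (R : realType) (n : nat) : sqnorm (0 : 'cV[R]_n) = 0.
Proof. by rewrite /sqnorm mulmx0 mxE. Qed.

Lemma sqr_le_sqnorm (R : realType) (n : nat) (x : 'cV[R]_n) l :
  x l 0 ^+ 2 <= sqnorm x.
Proof.
rewrite sqnormE (bigD1 l) //= lerDl sumr_ge0 // => k _; exact: sqr_ge0.
Qed.

Lemma nneseries_head (R : realType) (f : nat -> \bar R) N :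
  (forall k, 0 <= f k)%E -> (forall k, (N < k)%N -> f k = 0%E) ->
  (\sum_(N <= k <oo) f k = f N)%E.
Proof.
move=> f_ge0 f0; rewrite (@nneseries_split _ _ N 1) // addn1 big_nat1.
by rewrite eseries0 ?adde0 // => k Nk _; exact: f0.
Qed.

(** * Block structure in scalar coordinates *)

Section Coordinates.
Variables (R : realType) (q : nat) (n_ : 'I_q -> nat).
Local Notation N := (total_dim n_).
Implicit Types (M A B : 'M[R]_N) (G : digraph q) (l m k : 'I_N).

Definition block_of l : 'I_q := @tagnat.sig1 q n_ l.

Lemma block_of_Rank i (k : 'I_(n_ i)) : block_of (tagnat.Rank i k) = i.
Proof. exact: tagnat.Rank1K. Qed.

(** Carrying [block_of l = i] as a side equation avoids casts between the types ['I_(n_ i)]. *)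
Lemma forall_Rank (P : 'I_N -> Prop) i :
  (forall k : 'I_(n_ i), P (tagnat.Rank i k)) <->
  (forall l, block_of l = i -> P l).
Proof.
split=> [PR l li | Pl k]; last by apply: Pl; rewrite block_of_Rank.
by move: PR; rewrite -li => /(_ (tagnat.sig2 l)); rewrite tagnat.sig2K.
Qed.

Lemma eq_block_row M M' i :
  block_row M i = block_row M' i <->
  (forall l, block_of l = i -> forall m, M l m = M' l m).
Proof.
rewrite -(forall_Rank (fun l => forall m, M l m = M' l m)); split=> [/matrixP e k m|e].
  by have := e k m; rewrite !mxE.
by apply/matrixP => k m; rewrite !mxE.
Qed.

Lemma eq_submxblock M M' i j :
  submxblock M i j = submxblock M' i j <->
  (forall l m, block_of l = i -> block_of m = j -> M l m = M' l m).
Proof.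
split=> [/matrixP e l m li mj|e].
  move: l li m mj; apply/(forall_Rank (fun l => forall m, block_of m = j -> _)) => k.
  by apply/(forall_Rank (fun m => M _ m = M' _ m)) => k'; have := e k k'; rewrite !mxE.
by apply/matrixP => k k'; rewrite !mxE; apply: e; exact: block_of_Rank.
Qed.

Lemma submxblock_eq0 M i j :
  submxblock M i j = 0 <->
  (forall l m, block_of l = i -> block_of m = j -> M l m = 0).
Proof.
have -> : 0 = submxblock (0 : 'M[R]_N) i j by apply/matrixP => ? ?; rewrite !mxE.
by rewrite eq_submxblock; split=> e l m li mj; rewrite e // mxE.
Qed.

Lemma adjmx_eq0 G i j : (adjmx G i j = 0) <-> ~~ G j i.
Proof. by rewrite mxE; case: (G j i). Qed.

Lemma structuredP G M :
  structured G M <->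
  (forall l m, ~~ G (block_of m) (block_of l) -> M l m = 0).
Proof.
split=> [sM l m /adjmx_eq0/sM/submxblock_eq0 M0|M0 i j /adjmx_eq0 Gji].
  exact: M0.
by apply/submxblock_eq0 => l m li mj; apply: M0; rewrite li mj.
Qed.

Lemma input_diag (eps : R) B :
  input_matrices eps B -> B = diag_mx (\row_l B l l).
Proof.
case=> /is_diag_mxP dB _; apply/matrixP => l m; rewrite !mxE.
by have [->|lm] := eqVneq l m; rewrite ?mulr1n // mulr0n dB.
Qed.

Lemma input_gt0 (eps : R) B l : 0 < eps -> input_matrices eps B -> 0 < B l l.
Proof. by move=> e0 [_ /(_ l)]; exact: lt_le_trans. Qed.

Lemma input_diag_mx (eps : R) (b : 'rV[R]_N) :
  (forall l, eps <= b 0 l) -> input_matrices eps (diag_mx b).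
Proof.
by move=> b_ge; split=> [|l]; [exact: diag_mx_is_diag | rewrite mxE eqxx mulr1n].
Qed.

Lemma deadbeatE (eps : R) A B : 0 < eps -> input_matrices eps B ->
  deadbeat A B = - (diag_mx (\row_l (B l l)^-1) *m A).
Proof.
move=> eps_gt0 Bin; rewrite /deadbeat; congr (- (_ *m _)).
suff BK : B *m diag_mx (\row_l (B l l)^-1) = 1%:M.
  by rewrite -[LHS]mulmx1 -BK mulKmx // (mulmx1_unit BK).1.
rewrite [X in X *m _](input_diag Bin) mulmx_diag -diag_const_mx; congr diag_mx.
apply/rowP => l; rewrite !mxE divff // gt_eqF //; exact: input_gt0 Bin.
Qed.

(** Scaling the rows of [A] preserves its zeros, so the controller inherits the sparsity of the
    plant, and each row stays local as long as its factor does. Deadbeat and its competitor at a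
    sink both have this form. *)
Lemma scaling_design_method (GP GK GC : digraph q) (eps : R)
    (g : 'M[R]_N -> 'M[R]_N -> 'I_N -> R) (Gam : design_method R n_) :
  adjmx GC = 1%:M -> graph_sub GP GK ->
  (forall A B, structured GP A -> input_matrices eps B ->
     Gam A B = - (diag_mx (\row_l g A B l) *m A)) ->
  (forall A B A' B' l,
     block_row A (block_of l) = block_row A' (block_of l) ->
     B l l = B' l l -> g A B l = g A' B' l) ->
  design_methods GP GK GC eps Gam.
Proof.
move=> GC1 GPK GamE g_loc; split=> [A B sA Bin | i A B A' B' sA Bin sA' Bin' eqi].
  apply/structuredP => l m GKml; rewrite GamE // mul_diag_mx !mxE.
  rewrite (structuredP GP A).1 ?mulr0 ?oppr0 //; apply: contra GKml; exact: GPK.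
have [eqA /eq_submxblock eqB] := eqi i ltac:(by rewrite GC1 mxE eqxx).
rewrite !GamE //; apply/eq_block_row => l li m; rewrite !mul_diag_mx !mxE.
rewrite ((eq_block_row _ _ _).1 eqA) // (g_loc _ _ A' B') ?li //; exact: eqB.
Qed.

End Coordinates.

(** * Closed-loop cost *)

Section Cost.
Variables (R : realType) (q : nat) (n_ : 'I_q -> nat).
Local Notation N := (total_dim n_).
Implicit Types (A K : 'M[R]_N) (b d : 'rV[R]_N) (x : 'cV[R]_N).

(* [A *m diag_mx (1 - b d) = 0] makes the loop rest from time 2 on, and idle
   from time 1 on. *)
Lemma cost_scaling A b d x :
  (forall l m, A l m * (1 - b 0 m * d 0 m) = 0) ->
  cost (A, diag_mx b, x) (- (diag_mx d *m A)) =
  (\sum_l ((1 - b 0 l * d 0 l) ^+ 2 + d 0 l ^+ 2) * (A *m x) l 0 ^+ 2)%:E.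
Proof.
move=> AE; set K := - _; set cl := closed_loop A (diag_mx b) K x.
have Kx (y : 'cV_N) l : (K *m y) l 0 = - (d 0 l * (A *m y) l 0).
  by rewrite /K mulNmx -mulmxA mul_diag_mx !mxE.
have clS k l : cl k.+1 l 0 = (1 - b 0 l * d 0 l) * (A *m cl k) l 0.
  rewrite /cl /= -/K mxE mul_diag_mx [X in _ + X]mxE Kx; ring.
have Acl k : A *m cl k.+1 = 0.
  apply/colP => l; rewrite mxE [RHS]mxE big1 // => m _.
  by rewrite clS mulrA AE mul0r.
have cl0 k : cl k.+2 = 0.
  by apply/colP => l; rewrite clS Acl !mxE mulr0.
have Kcl0 k : K *m cl k.+1 = 0.
  by apply/colP => l; rewrite Kx Acl !mxE mulr0 oppr0.
(* States are counted from time 1 and inputs from time 0, so each series keeps exactly its first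
   term. *)
rewrite /cost -/K -/cl !nneseries_head //; last first.
- by case=> [|[|k]] // _; rewrite cl0 sqnorm0.
- by move=> k; rewrite lee_fin sqnorm_ge0.
- by case=> [|k] // _; rewrite Kcl0 sqnorm0.
- by move=> k; rewrite lee_fin sqnorm_ge0.
rewrite -EFinD !sqnormE -big_split /=; congr EFin; apply: eq_bigr => l _.
by rewrite clS Kx /=; ring.
Qed.

(** The terms kept pair up as [(x(1), u(0))] and [(x(2), u(1))], ready for one application of
    [one_step_bound] each. *)
Lemma cost_ge A B K x l (cl := closed_loop A B K x) :
  ((cl 1%N l 0 ^+ 2 + cl 2%N l 0 ^+ 2
    + ((K *m cl 0%N) l 0 ^+ 2 + (K *m cl 1%N) l 0 ^+ 2))%:E
   <= cost (A, B, x) K)%E.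
Proof.
rewrite /cost -/cl EFinD; apply: leeD.
  apply: le_trans (nneseries_lim_ge 3 _); last first.
    by move=> k _ _; rewrite lee_fin sqnorm_ge0.
  by rewrite big_ltn // big_nat1 -EFinD lee_fin lerD // sqr_le_sqnorm.
apply: le_trans (nneseries_lim_ge 2 _); last first.
  by move=> k _ _; rewrite lee_fin sqnorm_ge0.
by rewrite big_ltn // big_nat1 -EFinD lee_fin lerD // sqr_le_sqnorm.
Qed.

End Cost.

(** * Scalar inequalities *)

(* Cauchy-Schwarz: the cheapest way to split [a] between the input and the next
   state of a scalar plant [y = a + b u]. *)
Lemma one_step_bound (R : realType) (a b u y : R) :
  y = a + b * u -> a ^+ 2 / (1 + b ^+ 2) <= y ^+ 2 + u ^+ 2.
Proof.
move=> yE; rewrite ler_pdivrMr ?ltr_wpDr ?sqr_ge0 // -subr_ge0.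
rewrite (_ : _ - _ = (u + b * y) ^+ 2) ?sqr_ge0 // yE; ring.
Qed.

(** For large [b] the excess [1/b^2 - 1/(1+b^2)] is of order [1/b^4], small against [gam^2/(1+b^2)];
    what remains grows with [r^2] and overtakes the fixed [c]. *)
Lemma exists_costly_perturbation (R : realType) (gam c eps : R) :
  gam != 0 -> 0 < eps -> 0 <= c ->
  exists b r, eps <= b /\ forall t, 0 <= t <= 1 ->
    c + (r * t) ^+ 2 / b ^+ 2 <
    (r * t) ^+ 2 / (1 + b ^+ 2) + (r * gam) ^+ 2 / (1 + b ^+ 2).
Proof.
(* The summand [eps] keeps the input admissible; the other gives [b * |gam| >= 2]. *)
move=> gam0 eps_gt0 c_ge0; pose b := eps + 2 / `|gam|.
have gam_gt0 : 0 < `|gam| by rewrite normr_gt0.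
have b_ge : 2 / `|gam| <= b by rewrite lerDr ltW.
have b_gt0 : 0 < b by rewrite addr_gt0 // divr_gt0.
have b1 : 0 < 1 + b ^+ 2 by rewrite ltr_wpDr ?sqr_ge0.
have bgam : 2 <= (b * gam) ^+ 2.
  rewrite ler_pdivrMr // in b_ge.
  by rewrite -[X in _ <= X]real_normK ?num_real // normrM (gtr0_norm b_gt0); nra.
(* Half of the term in [gam], up to [r^2]: one half will cover [c], the other the excess of the
   terms in [t]. *)
pose s := gam ^+ 2 / 2 / (1 + b ^+ 2).
have s_gt0 : 0 < s by rewrite !divr_gt0 // exprn_even_gt0.
(* Chosen so that [c = (r - 1) * s] with [r >= 1], whence [c < r^2 * s]. *)
pose r := 1 + c / s; exists b, r; split=> [|t /andP[t_ge0 t_le1]].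
  by rewrite lerDl ltW // divr_gt0.
have cr : c < r ^+ 2 * s.
  have -> : c = (r - 1) * s by rewrite /r addrC addKr divfK // gt_eqF.
  have r_ge1 : 1 <= r by rewrite lerDl divr_ge0 // ltW.
  by rewrite ltr_pM2r //; nra.
have tb : (r * t) ^+ 2 / b ^+ 2 - (r * t) ^+ 2 / (1 + b ^+ 2) <= r ^+ 2 * s.
  have -> : (r * t) ^+ 2 / b ^+ 2 - (r * t) ^+ 2 / (1 + b ^+ 2) =
      r ^+ 2 * (t ^+ 2 / b ^+ 2 / (1 + b ^+ 2)).
    by field; rewrite !gt_eqF.
  rewrite ler_wpM2l ?sqr_ge0 // ler_pM2r ?invr_gt0 //.
  by rewrite ler_pdivrMr ?exprn_gt0 //; nra.
have -> : (r * gam) ^+ 2 / (1 + b ^+ 2) = r ^+ 2 * s + r ^+ 2 * s.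
  by rewrite /s; field; rewrite gt_eqF.
by lra.
Qed.

(** * Deadbeat control without and with sinks *)

Section DeadbeatMethod.
Variables (R : realType) (q : nat) (n_ : 'I_q -> nat) (eps : R).
Variables (GP GK GC : digraph q).
Local Notation N := (total_dim n_).
Hypotheses (n_gt0 : forall i, (1 <= n_ i)%N) (eps_gt0 : 0 < eps).
Hypotheses (GC1 : adjmx GC = 1%:M) (GPK : graph_sub GP GK).

Lemma method_costE (Gam : design_method R n_) A B x :
  method_cost Gam (A, B, x) = cost (A, B, x) (Gam A B).
Proof. by []. Qed.

Lemma deadbeat_cost (A B : 'M[R]_N) x : input_matrices eps B ->
  cost (A, B, x) (deadbeat A B) =
  (\sum_l (A *m x) l 0 ^+ 2 / B l l ^+ 2)%:E.
Proof.
move=> Bin; rewrite (deadbeatE A eps_gt0 Bin) {1}(input_diag Bin).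
have Bu l : B l l / B l l = 1.
  by rewrite divff // gt_eqF // (input_gt0 l eps_gt0 Bin).
rewrite cost_scaling => [|l m]; last by rewrite !mxE Bu subrr mulr0.
congr EFin; apply: eq_bigr => l _.
by rewrite !mxE Bu subrr expr0n add0r exprVn mulrC.
Qed.

Lemma deadbeat_design_method :
  design_methods GP GK GC eps (@deadbeat R q n_).
Proof.
apply: (@scaling_design_method _ _ _ _ _ _ _ (fun A B l => (B l l)^-1)) => //.
- by move=> A B _ Bin; rewrite (deadbeatE A eps_gt0 Bin).
- by move=> A B A' B' l _ ->.
Qed.

(* If the closed loop of [Gam] had a nonzero entry [gam] at [(m, p)], the
   initial state [e_p] would give [x(1)_m = gam].  The vertex of [m] feeds some
   other vertex; replacing there a single row of [(A, B)] by [(r e_m^T, b)] does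
   not change the controller row of [m], but forces a cost at time 1 that grows
   as [r^2], whereas deadbeat has reached the origin. *)
Lemma dominating_closed_loop_eq0 (Gam : design_method R n_) (A B : 'M[R]_N) :
  (forall i, ~ sink_node GP i) ->
  has_design_structure GP GC eps Gam ->
  (forall P, plants GP eps P ->
     (method_cost Gam P <= method_cost (@deadbeat R q n_) P)%E) ->
  structured GP A -> input_matrices eps B -> A + B *m Gam A B = 0.
Proof.
move=> nosink GamC dom sA Bin; apply/matrixP => m p; rewrite [RHS]mxE.
apply/eqP/negPn/negP; set gam := (A + _) m p => gam_neq0.
have [j [ji GPij]] : exists j, j != block_of m /\ GP (block_of m) j.
  exact: contrapT (nosink (block_of m)).
pose l : 'I_N := tagnat.Rank j (Ordinal (n_gt0 j)).
have lj : block_of l = j by exact: block_of_Rank.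
have ml : m != l by apply: contraNneq ji => ->; rewrite lj.
(* The deadbeat cost from [e_p] of the rows other than [l], which the perturbation leaves
   unchanged. *)
pose c := \sum_(k | k != l) A k p ^+ 2 / B k k ^+ 2.
have c_ge0 : 0 <= c by rewrite sumr_ge0 // => k _; rewrite divr_ge0 ?sqr_ge0.
have [b [r [eps_b lt_cost]]] :=
  exists_costly_perturbation gam_neq0 eps_gt0 c_ge0.
pose A' : 'M[R]_N := \matrix_(k, k') if k == l then r * (k' == m)%:R else A k k'.
pose B' := diag_mx (\row_(k < N) if k == l then b else B k k).
have sA' : structured GP A'.
  apply/structuredP => k k' GPk; rewrite mxE; case: eqP => [kl|_].
    case: eqP => [k'm|_]; last by rewrite mulr0.
    by rewrite kl k'm lj GPij in GPk.
  exact: (structuredP GP A).1 GPk.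
have Bin' : input_matrices eps B'.
  by apply: input_diag_mx => k; rewrite mxE; case: eqP => // _; case: Bin.
have B'll k : B' k k = if k == l then b else B k k by rewrite !mxE eqxx.
set K' := Gam A' B'; set x0 : 'cV[R]_N := delta_mx p 0.
have colp (M : 'M[R]_N) k : (M *m x0) k 0 = M k p.
  by rewrite -colE mxE.
set cl := closed_loop A' B' K' x0.
have clS t k : cl t.+1 k 0 = (A' *m cl t) k 0 + B' k k * (K' *m cl t) k 0.
  by rewrite /cl /= mxE /B' mul_diag_mx !mxE eqxx.
have cl1m : cl 1%N m 0 = gam.
  rewrite clS !colp B'll (negPf ml) mxE (negPf ml) /gam [in RHS]mxE.
  rewrite [X in (X *m _) m p](input_diag Bin) mul_diag_mx !mxE.
  congr (_ + _ * _).
  (* The controller row of [m] sees only the data of its own block, and [l] lies in another one. *)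
  apply: ((eq_block_row _ _ _).1 _ _ erefl).
  apply: GamC => // i; rewrite GC1 mxE.
  have [<- _|_] := eqVneq (block_of m) i; last by rewrite eqxx.
  split.
    apply/eq_block_row => k km k'; rewrite mxE ifN //.
    by apply: contraNneq ji => kl; rewrite -lj -kl km.
  apply/eq_submxblock => k k' km _; rewrite [in RHS](input_diag Bin) !mxE ifN //.
  by apply: contraNneq ji => kl; rewrite -lj -kl km.
have A'l (y : 'cV[R]_N) : (A' *m y) l 0 = r * y m 0.
  rewrite mxE (bigD1 m) //= big1 ?addr0 => [|k km]; rewrite mxE eqxx.
    by rewrite eqxx mulr1.
  by rewrite (negPf km) mulr0 mul0r.
have := dom (A', B', x0) (conj (conj sA' Bin') I).
rewrite !method_costE deadbeat_cost // -/K'.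
move/(le_trans (cost_ge A' B' K' x0 l)); rewrite -/cl lee_fin leNgt => /negP.
apply.
(* If [p = m], the new row already reads the initial state; this is the parameter [t], equal to 0 or
   1. *)
have -> : \sum_k (A' *m x0) k 0 ^+ 2 / B' k k ^+ 2 =
    c + (r * (p == m)%:R) ^+ 2 / b ^+ 2.
  rewrite (bigD1 l) //= addrC B'll eqxx colp mxE eqxx; congr (_ + _).
  by apply: eq_bigr => k kl; rewrite B'll colp mxE (negPf kl).
apply: lt_le_trans (lt_cost (p == m)%:R _) _.
  by case: (p == m); rewrite ?ler01 ?lexx.
have H1 : cl 1%N l 0 = r * (p == m)%:R + b * (K' *m cl 0%N) l 0.
  by rewrite clS A'l B'll eqxx mxE andbT (eq_sym m).
have H2 : cl 2%N l 0 = r * gam + b * (K' *m cl 1%N) l 0.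
  by rewrite clS A'l cl1m B'll eqxx.
by have := lerD (one_step_bound H1) (one_step_bound H2); lra.
Qed.

(** Never being worse already forces equality with deadbeat on every admissible [(A, B)], which
    rules out a strict inequality. *)
Lemma deadbeat_undominated :
  (forall i, ~ sink_node GP i) ->
  undominated (design_methods GP GK GC eps) (plants GP eps) (@deadbeat R q n_).
Proof.
move=> nosink; split; first exact: deadbeat_design_method.
move=> [Gam [[_ GamC] [dom [[[A B] x] [[[sA Bin] _]]]]]].
rewrite /= in sA Bin.
suff GamE : Gam A B = deadbeat A B by rewrite !method_costE GamE ltxx.
have ABG := dominating_closed_loop_eq0 nosink GamC dom sA Bin.
have Bu : B \in unitmx.
  rewrite (input_diag Bin) unitmxE det_diag unitfE.
  by apply/prodf_neq0 => l _; rewrite mxE gt_eqF // (input_gt0 l eps_gt0 Bin).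
rewrite /deadbeat -mulmxN -[LHS](mulKmx Bu); congr (_ *m _).
by apply/eqP; rewrite -addr_eq0 addrC ABG.
Qed.

(** The test reads only [A_ii], part of block row [i], so the choice of gain stays local. The value
    [b / (1 + b^2)] minimises [(1 - b d)^2 + d^2] over [d]. *)
Definition sink_gain (i : 'I_q) (A B : 'M[R]_N) (l : 'I_N) : R :=
  if (block_of l == i) && (submxblock A i i == 0)
  then B l l / (1 + B l l ^+ 2) else (B l l)^-1.

Definition sink_method i : design_method R n_ :=
  fun A B => - (diag_mx (\row_l sink_gain i A B l) *m A).

Lemma sink_design_method i :
  design_methods GP GK GC eps (sink_method i).
Proof.
apply: (@scaling_design_method _ _ _ _ _ _ _ (sink_gain i)) => //.
move=> A B A' B' l eqA eqB; rewrite /sink_gain eqB.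
case: eqP => //= li; congr (if _ then _ else _).
congr (_ == 0); apply/eq_submxblock => k k' ki _.
by apply: (eq_block_row _ _ _).1 eqA _ _ _; rewrite ki li.
Qed.

(* Column block [i] of [A] vanishes off the diagonal block, hence entirely when
   the gain differs from deadbeat. *)
Lemma sink_method_cost i (A B : 'M[R]_N) x :
  sink_node GP i -> structured GP A -> input_matrices eps B ->
  cost (A, B, x) (sink_method i A B) =
  (\sum_l (if (block_of l == i) && (submxblock A i i == 0)
           then (1 + B l l ^+ 2)^-1 else (B l l ^+ 2)^-1)
     * (A *m x) l 0 ^+ 2)%:E.
Proof.
move=> sink sA Bin; rewrite /sink_method {1}(input_diag Bin).
have B0 l : B l l != 0 by rewrite gt_eqF // (input_gt0 l eps_gt0 Bin).
have B1 l : 1 + B l l ^+ 2 != 0 by rewrite gt_eqF // ltr_wpDr ?sqr_ge0.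
rewrite cost_scaling /sink_gain => [|l m].
  congr EFin; apply: eq_bigr => l _; congr (_ * _); rewrite !mxE.
  case: ifP => _; first by field.
  by rewrite divff // subrr expr0n add0r exprVn.
rewrite !mxE; case: ifP => [/andP[/eqP mi /eqP Aii]|_]; last first.
  by rewrite divff // subrr mulr0.
have [li|li] := eqVneq (block_of l) i.
  by rewrite ((submxblock_eq0 _ _ _).1 Aii) ?mul0r.
rewrite ((structuredP GP A).1 sA) ?mul0r // mi; apply/negP => Gil.
by apply: sink; exists (block_of l).
Qed.

(** The costs compare term by term. A sink that is not isolated receives an edge from some other
    vertex, and exciting it along that edge gives strictness. *)
Lemma sink_method_dominates i :
  sink_node GP i -> ~ isolated_node GP i ->
  dominates (plants GP eps) (sink_method i) (@deadbeat R q n_).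
Proof.
move=> sink /contrapT[j [ji Gij]].
have {}Gij : GP j i by case: Gij => // Gij; case: sink; exists j.
have inv_lt (b : R) : eps <= b -> (1 + b ^+ 2)^-1 < (b ^+ 2)^-1.
  move=> /(lt_le_trans eps_gt0) b0.
  by rewrite ltf_pV2 ?posrE ?ltrDr ?exprn_gt0 // ltr_wpDr ?sqr_ge0.
have le_term (A B : 'M[R]_N) x l : input_matrices eps B ->
    (if (block_of l == i) && (submxblock A i i == 0)
     then (1 + B l l ^+ 2)^-1 else (B l l ^+ 2)^-1) * (A *m x) l 0 ^+ 2 <=
    (A *m x) l 0 ^+ 2 / B l l ^+ 2.
  move=> [_ B_ge]; rewrite [leRHS]mulrC ler_wpM2r ?sqr_ge0 //.
  by case: ifP => // _; exact: ltW (inv_lt _ _).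
split=> [[[A B] x] [[sA Bin] _]|].
  rewrite /= in sA Bin.
  rewrite !method_costE sink_method_cost // deadbeat_cost // lee_fin.
  by apply: ler_sum => l _; exact: le_term.
pose l : 'I_N := tagnat.Rank i (Ordinal (n_gt0 i)).
pose m : 'I_N := tagnat.Rank j (Ordinal (n_gt0 j)).
have li : block_of l = i by exact: block_of_Rank.
have mj : block_of m = j by exact: block_of_Rank.
(* A single unit entry from [j] into the sink: [A_ii = 0] because [j != i], so the modified gain is
   in force. *)
pose A : 'M[R]_N := delta_mx l m; pose B : 'M[R]_N := diag_mx (const_mx eps).
have Bin : input_matrices eps B by apply: input_diag_mx => k; rewrite mxE.
have sA : structured GP A.
  apply/structuredP => k k'; rewrite mxE.
  by case: eqP => [->|//]; case: eqP => [->|//]; rewrite li mj Gij.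
have Aii : submxblock A i i = 0.
  apply/submxblock_eq0 => k k' _ k'i; rewrite mxE.
  case: (k' =P m) k'i => [->|_ _]; last by rewrite andbF.
  by rewrite mj => /eqP; rewrite (negPf ji).
exists (A, B, delta_mx m 0); split=> //.
rewrite !method_costE sink_method_cost // deadbeat_cost // lte_fin.
rewrite [ltLHS](bigD1 l) // [ltRHS](bigD1 l) //=; apply: ltr_leD.
  rewrite -colE !mxE !eqxx li eqxx Aii eqxx /= expr1n mulr1 mul1r.
  exact: inv_lt.
by apply: ler_sum => k _; exact: le_term.
Qed.

End DeadbeatMethod.

Theorem theorem3p13 (R : realType) (q : nat) (n_ : 'I_q -> nat) (eps : R)
    (GP GK GC : digraph q) :
  (1 <= q)%N ->
  (forall i : 'I_q, (1 <= n_ i)%N) ->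
  0 < eps ->
  (forall i : 'I_q, ~ isolated_node GP i) ->
  adjmx GC = 1%:M ->
  graph_sub GP GK ->
  undominated (design_methods GP GK GC eps)
    (plants GP eps) (@deadbeat R q n_)
  <-> (forall i : 'I_q, ~ sink_node GP i).
Proof.
move=> _ n_gt0 eps_gt0 noiso GC1 GPK; split=> [[_ undom] i sink|nosink].
  apply: undom; exists (@sink_method R q n_ i); split.
    exact: sink_design_method.
  exact: sink_method_dominates.
exact: deadbeat_undominated.
Qed.
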